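(* Let $G$ be a finite group and let $H$ be a (not necessarily proper) subgroup of $G$. Then there exists a unique $v\in\operatorname{Im}\mathbb{Q}\mathrm{Ind}$ such that $\mathbb{Q}\mathrm{Res}(v)=[H\backslash H]$. Furthermore, $v\in\mathbb{Q}W$.
   Context: $\mathcal{B}(G)$ is the Burnside ring of $G$: the Grothendieck ring of the semi-ring of isomorphism classes of finite right $G$-sets (addition from disjoint union, multiplication from cartesian product with diagonal action). For $L$ a subgroup of $G$, $L\backslash G$ is the right $G$-set of right cosets of $L$, with $G$ acting by right translation, and $[L\backslash G]$ is its class. $\mathcal{B}(G)$ is a free $\mathbb{Z}$-module with basis the classes $[L\backslash G]$, $L$ ranging over representatives of the $G$-conjugacy classes of subgroups of $G$. Write $\mathbb{Q}\mathcal{B}(G):=\mathbb{Q}\otimes_{\mathbb{Z}}\mathcal{B}(G)$, and similarly for $H$. $\mathbb{Q}\mathrm{Res}:\mathbb{Q}\mathcal{B}(G)\to\mathbb{Q}\mathcal{B}(H)$ is the $\mathbb{Q}$-linear map induced by restricting $G$-actions to $H$, and $\mathbb{Q}\mathrm{Ind}:\mathbb{Q}\mathcal{B}(H)\to\mathbb{Q}\mathcal{B}(G)$ is the $\mathbb{Q}$-linear map induced by induction of $H$-sets, given by $\mathbb{Q}\mathrm{Ind}[K\backslash H]=[K\backslash G]$ for each subgroup $K$ of $H$. The set $DS$ of derived subgroups of $H$ in $G$ is the smallest set of subgroups of $G$ containing $H$ and such that $K\in DS$ and $g\in G$ imply $g^{-1}Kg\cap H\in DS$. Let $D$ be the set of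 $G$-conjugacy classes of elements of $DS$, and let $\mathbb{Q}W:=\operatorname{Span}_{\mathbb{Q}}\{[K\backslash G]\mid [K]\in D\}\subset\operatorname{Im}\mathbb{Q}\mathrm{Ind}\subset\mathbb{Q}\mathcal{B}(G)$. *)

(* Defs.v *)
From HB Require Import structures.
From mathcomp Require Import all_boot all_order all_fingroup all_algebra.
From mathcomp Require Import ring.
From mathcomp Require Import boolp.
From mathcomp Require Import freeg generic_quotient ring_quotient.

Set Implicit Arguments.
Unset Strict Implicit.
Unset Printing Implicit Defensive.

Import GRing.Theory.
Local Open Scope ring_scope.
Local Open Scope quotient_scope.

Section GrothendieckGroup.
Variable M : nmodType.

(* The pair (a, b) stands for the formal difference a - b. *)
Definition groth_eq (p q : M * M) : bool :=
  `[< exists k, p.1 + q.2 + k = q.1 + p.2 + k >].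

Lemma groth_eqP p q :
  reflect (exists k, p.1 + q.2 + k = q.1 + p.2 + k) (groth_eq p q).
Proof. exact: asboolP. Qed.

Lemma groth_eq_refl : reflexive groth_eq.
Proof. by move=> p; apply/groth_eqP; exists 0. Qed.

Lemma groth_eq_sym : symmetric groth_eq.
Proof. by move=> p q; apply/groth_eqP/groth_eqP => -[k e]; exists k. Qed.

Lemma groth_eq_trans : transitive groth_eq.
Proof.
move=> q p r /groth_eqP[k e] /groth_eqP[l e']; apply/groth_eqP.
exists (q.1 + q.2 + k + l).
have -> : p.1 + r.2 + (q.1 + q.2 + k + l) =
    (p.1 + q.2 + k) + (q.1 + r.2 + l).
  by rewrite !addrA [LHS](ACl (1*4*5*3*2*6)).
by rewrite e e' !addrA [LHS](ACl (4*2*1*5*3*6)).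
Qed.

Canonical groth_equiv :=
  EquivRel groth_eq groth_eq_refl groth_eq_sym groth_eq_trans.

Definition groth := {eq_quot groth_eq}.

HB.instance Definition _ := Choice.on groth.
HB.instance Definition _ : EqQuotient _ groth_eq groth := EqQuotient.on groth.

Lemma eq_groth p q :
  \pi_groth p = \pi_groth q <-> exists k, p.1 + q.2 + k = q.1 + p.2 + k.
Proof.
by split=> [/eqP | /groth_eqP e]; [rewrite eqquotE => /groth_eqP | apply/eqP; rewrite eqquotE].
Qed.

Definition groth_of (x : M) : groth := \pi_groth (x, 0).

Definition groth_zero : groth := \pi_groth (0, 0).
Definition groth_add (x y : groth) : groth :=
  \pi_groth ((repr x).1 + (repr y).1, (repr x).2 + (repr y).2).
Definition groth_opp (x : groth) : groth := \pi_groth ((repr x).2, (repr x).1).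

Lemma groth_reprP p : exists k,
  (repr (\pi_groth p)).1 + p.2 + k = p.1 + (repr (\pi_groth p)).2 + k.
Proof. by apply/eq_groth; rewrite reprK. Qed.

Lemma pi_groth_add p q :
  groth_add (\pi p) (\pi q) = \pi_groth (p.1 + q.1, p.2 + q.2).
Proof.
have [k e] := groth_reprP p; have [l e'] := groth_reprP q.
apply/eq_groth; exists (k + l); move: e e'.
case: (repr _) => a b; case: (repr _) => c d /= e e'.
have -> : a + c + (p.2 + q.2) + (k + l) = (a + p.2 + k) + (c + q.2 + l).
  by rewrite !addrA [LHS](ACl (1*3*5*2*4*6)).
by rewrite e e' !addrA [LHS](ACl (1*4*2*5*3*6)).
Qed.

Lemma pi_groth_opp p : groth_opp (\pi p) = \pi_groth (p.2, p.1).
Proof.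
have [k e] := groth_reprP p; apply/eq_groth; exists k; move: e.
by case: (repr _) => a b /= e; rewrite [b + _]addrC [p.2 + _]addrC.
Qed.

Lemma groth_addA : associative groth_add.
Proof.
by elim/quotW=> p; elim/quotW=> q; elim/quotW=> r; rewrite !pi_groth_add !addrA.
Qed.

Lemma groth_addC : commutative groth_add.
Proof.
elim/quotW=> p; elim/quotW=> q; rewrite !pi_groth_add.
by rewrite [p.1 + _]addrC [p.2 + _]addrC.
Qed.

Lemma groth_add0 : left_id groth_zero groth_add.
Proof. by elim/quotW=> -[a b]; rewrite pi_groth_add !add0r. Qed.

Lemma groth_addN : left_inverse groth_zero groth_opp groth_add.
Proof.
elim/quotW=> p; rewrite pi_groth_opp pi_groth_add; apply/eq_groth; exists 0.
by rewrite /= !addr0 add0r addrC.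
Qed.

HB.instance Definition _ :=
  GRing.isZmodule.Build groth groth_addA groth_addC groth_add0 groth_addN.

Lemma pi_grothD p q : \pi_groth p + \pi q = \pi_groth (p.1 + q.1, p.2 + q.2).
Proof. exact: pi_groth_add. Qed.

Lemma pi_grothE p : \pi_groth p = groth_of p.1 - groth_of p.2.
Proof.
rewrite [- _]pi_groth_opp pi_grothD /= addr0 add0r; by case: p.
Qed.

Lemma groth_of_is_nmod_morphism : nmod_morphism groth_of.
Proof. by split=> // x y; rewrite pi_grothD /= addr0. Qed.

HB.instance Definition _ :=
  GRing.isNmodMorphism.Build M groth groth_of groth_of_is_nmod_morphism.

End GrothendieckGroup.

Section GrothendieckRing.
Variable M : comPzSemiRingType.

Definition groth_mul (x y : groth M) : groth M :=
  \pi_(groth _) ((repr x).1 * (repr y).1 + (repr x).2 * (repr y).2,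
       (repr x).1 * (repr y).2 + (repr x).2 * (repr y).1).

Lemma groth_mulC : commutative groth_mul.
Proof.
by move=> x y; congr (\pi_(groth _) (_, _)); [congr (_ + _) | rewrite addrC; congr (_ + _)];
  rewrite mulrC.
Qed.

Lemma pi_groth_mul p q : groth_mul (\pi p) (\pi q) =
  \pi_(groth _) (p.1 * q.1 + p.2 * q.2, p.1 * q.2 + p.2 * q.1).
Proof.
suff half x (r : M * M) : groth_mul (\pi r) x =
    \pi_(groth _) (r.1 * (repr x).1 + r.2 * (repr x).2,
         r.1 * (repr x).2 + r.2 * (repr x).1).
  rewrite half; have [k e] := groth_reprP q; apply/eq_groth; move: e.
  case: (repr _) => c d /= e; exists ((p.1 + p.2) * k).
  have -> : p.1 * c + p.2 * d + (p.1 * q.2 + p.2 * q.1) + (p.1 + p.2) * k =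
    p.1 * (c + q.2 + k) + p.2 * (q.1 + d + k) by ring.
  by rewrite -e {1}e; ring.
have [k e] := groth_reprP r; apply/eq_groth; move: e.
rewrite /groth_mul; case: (repr x) => c d; case: (repr _) => a b /= e.
exists (k * (c + d)).
have -> : a * c + b * d + (r.1 * d + r.2 * c) + k * (c + d) =
  (a + r.2 + k) * c + (r.1 + b + k) * d by ring.
by rewrite -e {1}e; ring.
Qed.

Lemma groth_mulA : associative groth_mul.
Proof.
elim/quotW=> p; elim/quotW=> q; elim/quotW=> r; rewrite !pi_groth_mul /=.
by congr (\pi_(groth _) (_, _)); ring.
Qed.

Lemma groth_mul1 : left_id (groth_of (1 : M)) groth_mul.
Proof.
elim/quotW=> -[a b]; rewrite pi_groth_mul /=.
by congr (\pi_(groth _) (_, _)); ring.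
Qed.

Lemma groth_mulDl : left_distributive groth_mul +%R.
Proof.
elim/quotW=> p; elim/quotW=> q; elim/quotW=> r.
rewrite pi_grothD !pi_groth_mul pi_grothD /=.
by congr (\pi_(groth _) (_, _)); ring.
Qed.

HB.instance Definition _ := GRing.Zmodule_isComPzRing.Build (groth M)
  groth_mulA groth_mulC groth_mul1 groth_mulDl.

End GrothendieckRing.

Section GrothendieckMap.
Variables (M N : nmodType) (f : {additive M -> N}).

Definition groth_map (x : groth M) : groth N :=
  \pi_(groth _) (f (repr x).1, f (repr x).2).

Lemma pi_groth_map p : groth_map (\pi p) = \pi_(groth _) (f p.1, f p.2).
Proof.
have [k e] := groth_reprP p; apply/eq_groth; exists (f k).
by rewrite /= -!raddfD e.
Qed.

Lemma groth_map_is_nmod_morphism : nmod_morphism groth_map.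
Proof.
split=> [|]; first by rewrite pi_groth_map raddf0.
elim/quotW=> p; elim/quotW=> q.
by rewrite pi_grothD !pi_groth_map pi_grothD !raddfD.
Qed.

HB.instance Definition _ := GRing.isNmodMorphism.Build (groth M) (groth N)
  groth_map groth_map_is_nmod_morphism.

Lemma groth_map_of x : groth_map (groth_of x) = groth_of (f x).
Proof. by rewrite pi_groth_map raddf0. Qed.

End GrothendieckMap.

Section TensorQ.
Variable A : zmodType.

Local Notation F := {freeg (rat * A)}.
Local Notation gen q a := (<< (q, a) >> : F).

Inductive tens_rel : F -> Prop :=
| tens_rel0 : tens_rel 0
| tens_relB x y : tens_rel x -> tens_rel y -> tens_rel (x - y)
| tens_rel_l q r a : tens_rel (gen (q + r) a - gen q a - gen r a)
| tens_rel_r q a b : tens_rel (gen q (a + b) - gen q a - gen q b).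

Definition tens_relb : {pred F} := fun x => `[< tens_rel x >].

Lemma tens_relb_zmod_closed : zmod_closed tens_relb.
Proof.
split=> [|x y /asboolP rx /asboolP ry]; apply/asboolP; first exact: tens_rel0.
exact: tens_relB.
Qed.

HB.instance Definition _ :=
  GRing.isZmodClosed.Build F tens_relb tens_relb_zmod_closed.

(* Q (x)_Z A: the free abelian group on rat * A modulo biadditivity. *)
Definition tensQ := {ideal_quot tens_relb}.

HB.instance Definition _ := GRing.Zmodule.on tensQ.

Definition tens_pi (x : F) : tensQ := \pi_{ideal_quot tens_relb} x.
Definition tens (q : rat) (a : A) : tensQ := tens_pi (gen q a).

Lemma tens_piB : {morph tens_pi : x y / x - y}.
Proof. by move=> x y; rewrite /tens_pi !piE. Qed.

Lemma tens_pi0 : tens_pi 0 = 0.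
Proof. by rewrite -(subrr 0) tens_piB subrr. Qed.

Lemma tens_piN : {morph tens_pi : x / - x}.
Proof. by move=> x; rewrite -[- x]add0r tens_piB tens_pi0 add0r. Qed.

Lemma tens_piD : {morph tens_pi : x y / x + y}.
Proof. by move=> x y; rewrite -{1}[y]opprK tens_piB tens_piN opprK. Qed.

Lemma tensQW (P : tensQ -> Prop) : (forall x, P (tens_pi x)) -> forall x, P x.
Proof. by move=> Px x; rewrite -[x]reprK; apply: Px. Qed.

Lemma eq_tensQ x y : tens_pi x = tens_pi y <-> tens_rel (x - y).
Proof.
split=> [e|r]; last by apply/eqP; rewrite -Quotient.idealrBE; apply/asboolP.
apply/asboolP; suff: x - y \in tens_relb by [].
by rewrite Quotient.idealrBE -/(tens_pi x) e.
Qed.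

Lemma tensDl q r a : tens (q + r) a = tens q a + tens r a.
Proof.
apply/eqP; rewrite -subr_eq0 opprD addrA -!tens_piB -[0]tens_pi0.
by apply/eqP/eq_tensQ; rewrite subr0; apply: tens_rel_l.
Qed.

Lemma tensDr q a b : tens q (a + b) = tens q a + tens q b.
Proof.
apply/eqP; rewrite -subr_eq0 opprD addrA -!tens_piB -[0]tens_pi0.
by apply/eqP/eq_tensQ; rewrite subr0; apply: tens_rel_r.
Qed.

Definition biadditive (V : zmodType) (f : rat -> A -> V) :=
  (forall a, {morph f^~ a : q r / q + r}) /\
  (forall q, {morph f q : a b / a + b}).

Definition tens_lift (V : zmodType) (f : rat -> A -> V) (x : tensQ) : V :=
  fglift (M := zmodule V) (fun p => f p.1 p.2) (repr x).

Section Lift.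
Variables (V : zmodType) (f : rat -> A -> V).
Hypothesis bif : biadditive f.

Local Notation lift := (fglift (M := zmodule V) (fun p => f p.1 p.2)).

Lemma tens_rel_lift x : tens_rel x -> lift x = 0.
Proof.
have [fDl fDr] := bif.
elim=> [|{}x y _ ex _ ey|q r a|q a b].
- by rewrite -(subrr 0) lift_is_additive subrr.
- by rewrite lift_is_additive ex ey subrr.
- by rewrite !lift_is_additive !liftU !scale1r /= fDl addrAC addrK subrr.
- by rewrite !lift_is_additive !liftU !scale1r /= fDr addrAC addrK subrr.
Qed.

Lemma pi_tens_lift (x : F) :
  tens_lift f (tens_pi x) = lift x.
Proof.
apply/eqP; rewrite -subr_eq0; apply/eqP.
rewrite -[RHS](@tens_rel_lift (repr (tens_pi x) - x)) ?lift_is_additive //.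
by apply/eq_tensQ; rewrite /tens_pi reprK.
Qed.

Lemma tens_liftE q a : tens_lift f (tens q a) = f q a.
Proof. by rewrite pi_tens_lift liftU scale1r. Qed.

Lemma tens_lift_is_zmod_morphism : zmod_morphism (tens_lift f).
Proof.
elim/tensQW=> x; elim/tensQW=> y.
by rewrite -tens_piB !pi_tens_lift lift_is_additive.
Qed.

End Lift.

Lemma tens_ind (P : tensQ -> Prop) :
  (forall x y, P x -> P y -> P (x - y)) -> (forall q a, P (tens q a)) ->
  forall x, P x.
Proof.
move=> PB Pt; have P0 : P 0 by rewrite -(subrr (tens 0 0)); apply: PB.
have PD x y : P x -> P y -> P (x + y).
  by move=> Px Py; rewrite -[y]opprK -[- y]sub0r; apply/PB/PB.
elim/tensQW=> x; rewrite -(freeg_sumE x).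
elim: (dom x) => [|[q a] s IHs]; first by rewrite big_nil tens_pi0.
rewrite big_cons tens_piD; apply: (PD _ _ _ IHs).
have Pn n : P (tens_pi (<< n%:Z *g (q, a) >> : F)).
  elim: n => [|n IHn]; first by rewrite freegU0 tens_pi0.
  by rewrite intS -freegUD tens_piD; apply: (PD _ _ _ IHn); apply: Pt.
case: (coeff _ _) => n; first exact: Pn.
by rewrite NegzE -freegUN -[- _]sub0r tens_piB tens_pi0; apply: PB.
Qed.

Lemma tens_scale_biadditive (q : rat) : biadditive (fun r => tens (q * r)).
Proof. by split=> [a r s | r a b] /=; rewrite ?mulrDr (tensDl, tensDr). Qed.

Definition tens_scale (q : rat) : tensQ -> tensQ :=
  tens_lift (fun r => tens (q * r)).

Lemma tens_scaleE q r a : tens_scale q (tens r a) = tens (q * r) a.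
Proof. exact/tens_liftE/tens_scale_biadditive. Qed.

Lemma tens_scaleB q : zmod_morphism (tens_scale q).
Proof. exact/tens_lift_is_zmod_morphism/tens_scale_biadditive. Qed.

Lemma tens_scaleD q : {morph tens_scale q : x y / x + y}.
Proof.
move=> x y; have s0 : tens_scale q 0 = 0.
  by rewrite -[in LHS](subrr 0) tens_scaleB subrr.
by rewrite -{1}[y]opprK -[- y]sub0r !tens_scaleB s0 sub0r opprK.
Qed.

Lemma tens_scaleA q r x : tens_scale q (tens_scale r x) = tens_scale (q * r) x.
Proof.
elim/tens_ind: x => [x y ex ey|s a]; first by rewrite !tens_scaleB ex ey.
by rewrite !tens_scaleE mulrA.
Qed.

Lemma tens_scale1 : left_id 1 tens_scale.
Proof.
elim/tens_ind=> [x y ex ey|s a]; first by rewrite tens_scaleB ex ey.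
by rewrite tens_scaleE mul1r.
Qed.

Lemma tens_scaleDl x : {morph tens_scale^~ x : q r / q + r}.
Proof.
move=> q r; elim/tens_ind: x => [x y /= ex ey|s a] /=.
  by rewrite !tens_scaleB ex ey opprD addrACA.
by rewrite !tens_scaleE mulrDl tensDl.
Qed.

HB.instance Definition _ := GRing.Zmodule_isLmodule.Build rat tensQ
  tens_scaleA tens_scale1 tens_scaleD tens_scaleDl.

Lemma scale_tens q r a : q *: tens r a = tens (q * r) a.
Proof. exact: tens_scaleE. Qed.

End TensorQ.

Section TensorMap.
Variables (A B : zmodType) (f : {additive A -> B}).

Lemma tens_map_biadditive : biadditive (fun q a => tens q (f a)).
Proof. by split=> [a q r | q a b] /=; rewrite ?raddfD (tensDl, tensDr). Qed.

Definition tens_map : tensQ A -> tensQ B := tens_lift (fun q a => tens q (f a)).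

Lemma tens_mapE q a : tens_map (tens q a) = tens q (f a).
Proof. exact/tens_liftE/tens_map_biadditive. Qed.

Lemma tens_map_is_linear : linear tens_map.
Proof.
have mB := tens_lift_is_zmod_morphism tens_map_biadditive.
pose g : {additive _ -> _} := HB.pack tens_map
  (GRing.isZmodMorphism.Build _ _ tens_map mB).
move=> q x y; rewrite -[tens_map]/(g : _ -> _) raddfD; congr (_ + _).
elim/tens_ind: x => [x z ex ez|r a].
  by rewrite scalerBr !raddfB ex ez.
by rewrite scale_tens /= !tens_mapE scale_tens.
Qed.

HB.instance Definition _ := GRing.isLinear.Build rat (tensQ A) (tensQ B) _
  tens_map tens_map_is_linear.

End TensorMap.

(* An [action G T] is a right action of G on T; its values outside of G are   *)
(* junk, so equivariance is only required over G.                             *)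
Section ActionIso.
Variables (gT : finGroupType) (G : {group gT}).

Definition action_iso (S T : Type) (toS : action G S) (toT : action G T) :=
  exists2 f : S -> T, bijective f &
    forall x a, a \in G -> f (toS x a) = toT (f x) a.

Lemma action_iso_refl (S : Type) (to : action G S) : action_iso to to.
Proof. by exists id => //; exists id. Qed.

Lemma action_iso_sym (S T : Type) (toS : action G S) (toT : action G T) :
  action_iso toS toT -> action_iso toT toS.
Proof.
case=> f [g fK gK] fE; exists g => [|x a Ga]; first by exists f.
by apply: (can_inj fK); rewrite fE ?gK.
Qed.

Lemma action_iso_trans (S T U : Type) (toS : action G S) (toT : action G T)
    (toU : action G U) :
  action_iso toS toT -> action_iso toT toU -> action_iso toS toU.
Proof.
case=> f bf fE [g bg gE]; exists (g \o f) => [|x a Ga /=]; first exact: bij_comp.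
by rewrite fE ?gE.
Qed.

End ActionIso.

Section Constructions.
Variables (gT : finGroupType) (G : {group gT}).

Lemma empty_is_action : is_action G (fun (x : void) (_ : gT) => x).
Proof. by split=> [a []|[]]. Qed.
Definition empty_action := Action empty_is_action.

Lemma point_is_action : is_action G (fun (x : unit) (_ : gT) => x).
Proof. by split=> [a [] []|[]]. Qed.
Definition point_action := Action point_is_action.

Section Binary.
Variables (S T : finType) (toS : action G S) (toT : action G T).

Definition sum_act (x : S + T) (a : gT) : S + T :=
  match x with inl s => inl (toS s a) | inr t => inr (toT t a) end.

Lemma sum_is_action : is_action G sum_act.
Proof.
split=> [a [s|t] [s'|t'] //= []|[s|t] a b Ga Gb /=]; try by rewrite actMin.
  by move/act_inj->.
by move/act_inj->.
Qed.
Definition sum_action := Action sum_is_action.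

Definition prod_act (x : S * T) (a : gT) : S * T := (toS x.1 a, toT x.2 a).

Lemma prod_is_action : is_action G prod_act.
Proof.
split=> [a [s t] [s' t'] []|[s t] a b Ga Gb].
  by move=> /= /act_inj-> /act_inj->.
by rewrite /prod_act !actMin.
Qed.
Definition prod_action := Action prod_is_action.

End Binary.

Section Transport.
Variables (T : finType) (to : action G T).

Definition enum_act (i : 'I_#|T|) (a : gT) : 'I_#|T| :=
  enum_rank (to (enum_val i) a).

Lemma enum_is_action : is_action G enum_act.
Proof.
split=> [a i j|i a b Ga Gb].
  by move=> /enum_rank_inj/act_inj/enum_val_inj.
by rewrite /enum_act enum_rankK actMin.
Qed.
Definition enum_action := Action enum_is_action.

Lemma enum_action_iso : action_iso enum_action to.
Proof.
exists enum_val => [|i a Ga]; last by rewrite /= /enum_act enum_rankK.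
by exists enum_rank; [apply: enum_valK | apply: enum_rankK].
Qed.

End Transport.
End Constructions.

(* Every finite G-set is isomorphic to one carried by some 'I_n, so that the  *)
(* isomorphism classes of finite G-sets form a (small) type.                  *)
Record gset (gT : finGroupType) (G : {group gT}) := GSet {
  gset_card : nat;
  gset_act :> action G 'I_gset_card }.

HB.instance Definition _ gT G := gen_eqMixin (@gset gT G).
HB.instance Definition _ gT G := gen_choiceMixin (@gset gT G).

Section IsoClass.
Variables (gT : finGroupType) (G : {group gT}).

Definition gset_iso (X Y : gset G) : bool := `[< action_iso X Y >].

Lemma gset_iso_refl : reflexive gset_iso.
Proof. by move=> X; apply/asboolP; apply: action_iso_refl. Qed.

Lemma gset_iso_sym : symmetric gset_iso.
Proof. by move=> X Y; apply/asboolP/asboolP; apply: action_iso_sym. Qed.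

Lemma gset_iso_trans : transitive gset_iso.
Proof.
move=> Y X Z /asboolP XY /asboolP YZ; apply/asboolP.
exact: action_iso_trans XY YZ.
Qed.

Canonical gset_iso_equiv :=
  EquivRel gset_iso gset_iso_refl gset_iso_sym gset_iso_trans.

Definition isoclass := {eq_quot gset_iso}.

HB.instance Definition _ := Choice.on isoclass.
HB.instance Definition _ : EqQuotient _ gset_iso isoclass :=
  EqQuotient.on isoclass.

Definition iso_class (T : finType) (to : action G T) : isoclass :=
  \pi_isoclass (GSet (enum_action to)).

Lemma eq_iso_class (S T : finType) (toS : action G S) (toT : action G T) :
  iso_class toS = iso_class toT <-> action_iso toS toT.
Proof.
have eS := enum_action_iso toS; have eT := enum_action_iso toT.
split=> [/eqP | eST].
  rewrite eqquotE => /asboolP /= e.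
  apply: action_iso_trans (action_iso_sym eS) _.
  exact: action_iso_trans e eT.
apply/eqP; rewrite eqquotE; apply/asboolP => /=.
by apply: action_iso_trans eS (action_iso_trans eST (action_iso_sym eT)).
Qed.

Lemma iso_class_repr (x : isoclass) : iso_class (repr x) = x.
Proof.
rewrite -[RHS]reprK; apply/eqP; rewrite eqquotE; apply/asboolP.
exact: enum_action_iso.
Qed.

Lemma repr_iso_class (T : finType) (to : action G T) :
  action_iso (repr (iso_class to)) to.
Proof. by apply/eq_iso_class; rewrite iso_class_repr. Qed.

Lemma isoclassW (P : isoclass -> Prop) :
  (forall (T : finType) (to : action G T), P (iso_class to)) -> forall x, P x.
Proof. by move=> PT x; rewrite -[x]iso_class_repr. Qed.

Definition isoclass_add (x y : isoclass) : isoclass :=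
  iso_class (sum_action (repr x) (repr y)).
Definition isoclass_mul (x y : isoclass) : isoclass :=
  iso_class (prod_action (repr x) (repr y)).

Lemma iso_class_sum (S T : finType) (toS : action G S) (toT : action G T) :
  isoclass_add (iso_class toS) (iso_class toT) = iso_class (sum_action toS toT).
Proof.
apply/eq_iso_class.
have [f [f' fK f'K] fE] := repr_iso_class toS.
have [g [g' gK g'K] gE] := repr_iso_class toT.
exists (fun x => match x with inl s => inl (f s) | inr t => inr (g t) end).
  exists (fun x => match x with inl s => inl (f' s) | inr t => inr (g' t) end).
    by case=> ?; rewrite ?fK ?gK.
  by case=> ?; rewrite ?f'K ?g'K.
by case=> ? a Ga /=; rewrite ?fE ?gE.
Qed.

Lemma iso_class_prod (S T : finType) (toS : action G S) (toT : action G T) :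
  isoclass_mul (iso_class toS) (iso_class toT) = iso_class (prod_action toS toT).
Proof.
apply/eq_iso_class.
have [f [f' fK f'K] fE] := repr_iso_class toS.
have [g [g' gK g'K] gE] := repr_iso_class toT.
exists (fun x => (f x.1, g x.2)).
  by exists (fun x => (f' x.1, g' x.2)) => -[s t] /=; rewrite ?fK ?gK ?f'K ?g'K.
by move=> [s t] a Ga /=; rewrite /prod_act /= fE ?gE.
Qed.

Lemma isoclass_addA : associative isoclass_add.
Proof.
elim/isoclassW=> S tS; elim/isoclassW=> T tT; elim/isoclassW=> U tU.
rewrite !iso_class_sum; apply/eq_iso_class.
exists (fun x : S + (T + U) => match x with
  | inl s => inl (inl s) | inr (inl t) => inl (inr t) | inr (inr u) => inr u
  end); last by case=> [|[]].
exists (fun x : (S + T) + U => match x with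
  | inl (inl s) => inl s | inl (inr t) => inr (inl t) | inr u => inr (inr u)
  end); first by case=> [|[]].
by case=> [[]|].
Qed.

Lemma isoclass_addC : commutative isoclass_add.
Proof.
elim/isoclassW=> S tS; elim/isoclassW=> T tT.
rewrite !iso_class_sum; apply/eq_iso_class.
exists (fun x : S + T => match x with inl s => inr s | inr t => inl t end).
  exists (fun x : T + S => match x with inl s => inr s | inr t => inl t end).
    by case.
  by case.
by case.
Qed.

Lemma isoclass_add0 : left_id (iso_class (empty_action G)) isoclass_add.
Proof.
elim/isoclassW=> T tT; rewrite iso_class_sum; apply/eq_iso_class.
exists (fun x : void + T => match x with inl s => of_void _ s | inr t => t end).
  by exists inr => [[]|].
by case.
Qed.

HB.instance Definition _ := GRing.isNmodule.Build isoclass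
  isoclass_addA isoclass_addC isoclass_add0.

Lemma isoclass_mulA : associative isoclass_mul.
Proof.
elim/isoclassW=> S tS; elim/isoclassW=> T tT; elim/isoclassW=> U tU.
rewrite !iso_class_prod; apply/eq_iso_class.
exists (fun x : S * (T * U) => ((x.1, x.2.1), x.2.2)) => //.
by exists (fun x : S * T * U => (x.1.1, (x.1.2, x.2))); [case=> ? [] | case=> -[]].
Qed.

Lemma isoclass_mulC : commutative isoclass_mul.
Proof.
elim/isoclassW=> S tS; elim/isoclassW=> T tT.
rewrite !iso_class_prod; apply/eq_iso_class.
exists (fun x : S * T => (x.2, x.1)) => //.
by exists (fun x : T * S => (x.2, x.1)); case.
Qed.

Lemma isoclass_mul1 : left_id (iso_class (point_action G)) isoclass_mul.
Proof.
elim/isoclassW=> T tT; rewrite iso_class_prod; apply/eq_iso_class.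
exists (fun x : unit * T => x.2) => //.
by exists (fun t => (tt, t)) => // -[[]].
Qed.

Lemma isoclass_mulDl : left_distributive isoclass_mul isoclass_add.
Proof.
elim/isoclassW=> S tS; elim/isoclassW=> T tT; elim/isoclassW=> U tU.
rewrite iso_class_sum !iso_class_prod iso_class_sum; apply/eq_iso_class.
exists (fun x : (S + T) * U => match x.1 with
  | inl s => inl (s, x.2) | inr t => inr (t, x.2) end); last by case=> -[].
exists (fun x : S * U + T * U => match x with
  | inl p => (inl p.1, p.2) | inr p => (inr p.1, p.2) end); first by case=> -[].
by case=> -[].
Qed.

Lemma isoclass_mul0 : left_zero (iso_class (empty_action G)) isoclass_mul.
Proof.
elim/isoclassW=> T tT; rewrite iso_class_prod; apply/eq_iso_class.
exists (fun x : void * T => x.1); last by case.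
by exists (of_void _); case.
Qed.

HB.instance Definition _ := GRing.Nmodule_isComPzSemiRing.Build isoclass
  isoclass_mulA isoclass_mulC isoclass_mul1 isoclass_mulDl isoclass_mul0.

Lemma iso_class0 : iso_class (empty_action G) = 0.
Proof. by []. Qed.

Lemma iso_classD (S T : finType) (toS : action G S) (toT : action G T) :
  iso_class (sum_action toS toT) = iso_class toS + iso_class toT.
Proof. by rewrite [RHS]iso_class_sum. Qed.

Lemma iso_class1 : iso_class (point_action G) = 1.
Proof. by []. Qed.

Lemma iso_classM (S T : finType) (toS : action G S) (toT : action G T) :
  iso_class (prod_action toS toT) = iso_class toS * iso_class toT.
Proof. by rewrite [RHS]iso_class_prod. Qed.

Definition burnside := groth isoclass.
HB.instance Definition _ := GRing.ComPzRing.on burnside.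

Definition Qburnside := tensQ burnside.
HB.instance Definition _ := GRing.Lmodule.on Qburnside.

(* The class 1 (x) [T] of a finite G-set T in Q (x) B(G). *)
Definition Qclass (T : finType) (to : action G T) : Qburnside :=
  tens 1 (groth_of (iso_class to) : burnside).

End IsoClass.

Section Cosets.
Variables (gT : finGroupType) (L G : {group gT}).

Definition coset_gset : finType := {A : {set gT} | A \in rcosets L G}.

Lemma coset_subact_dom :
  (G \subset subact_dom (fun A : {set gT} => A \in rcosets L G) 'Rs)%g.
Proof.
rewrite /subact_dom (_ : [set _ | _] = rcosets L G); last first.
  by apply/setP=> A; rewrite inE.
exact: actsRs_rcosets.
Qed.

Definition coset_action : action G coset_gset :=
  ('Rs^? \ coset_subact_dom)%act.

Lemma val_coset_action A a : a \in G ->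
  val (coset_action A a) = (val A :* a)%g.
Proof.
by move=> Ga; rewrite /= val_subact (subsetP coset_subact_dom) //= rcosetE.
Qed.

End Cosets.

Section Restriction.
Variables (gT : finGroupType) (G H : {group gT}) (sHG : H \subset G).

Definition isoclass_res (x : isoclass G) : isoclass H :=
  iso_class (repr x \ sHG)%act.

Lemma res_action_iso (S T : finType) (toS : action G S) (toT : action G T) :
  action_iso toS toT -> action_iso (toS \ sHG)%act (toT \ sHG)%act.
Proof.
by case=> f bf fE; exists f => // x a Ha; apply/fE/(subsetP sHG).
Qed.

Lemma isoclass_resE (T : finType) (to : action G T) :
  isoclass_res (iso_class to) = iso_class (to \ sHG)%act.
Proof. exact/eq_iso_class/res_action_iso/repr_iso_class. Qed.

Lemma isoclass_res_is_nmod_morphism : nmod_morphism isoclass_res.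
Proof.
split=> [|].
  by rewrite -!iso_class0 isoclass_resE; apply/eq_iso_class; exists id; first by exists id.
elim/isoclassW=> S tS; elim/isoclassW=> T tT.
rewrite -iso_classD !isoclass_resE -iso_classD; apply/eq_iso_class.
by exists id; first by exists id.
Qed.

HB.instance Definition _ := GRing.isNmodMorphism.Build (isoclass G) (isoclass H)
  isoclass_res isoclass_res_is_nmod_morphism.

Definition QRes : {linear Qburnside G -> Qburnside H} :=
  tens_map (groth_map isoclass_res).

Lemma QRes_class (T : finType) (to : action G T) :
  QRes (Qclass to) = Qclass (to \ sHG)%act.
Proof. by rewrite /QRes /Qclass /= tens_mapE /= groth_map_of /= isoclass_resE. Qed.

End Restriction.

Section Induction.
Variables (gT : finGroupType) (H G : {group gT}).

(* The induced G-set S x_H G: pairs (x, g) modulo (xh, g) ~ (x, hg), h in H,  *)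
(* with G acting by right multiplication on the second component.             *)
Section InducedSet.
Variables (S : finType) (to : action H S).

Definition ind_eq (p q : S * subg_of G) : bool :=
  [exists h in H, (q.1 == to p.1 h) && (val p.2 == h * val q.2)%g].

Lemma ind_eqP p q : reflect
  (exists h, [/\ h \in H, q.1 = to p.1 h & val p.2 = h * val q.2]%g)
  (ind_eq p q).
Proof.
apply: (iffP exists_inP) => [[h Hh /andP[/eqP e1 /eqP e2]]|[h [Hh e1 e2]]].
  by exists h.
by exists h => //; rewrite e1 e2 !eqxx.
Qed.

Lemma ind_eq_refl : reflexive ind_eq.
Proof. by move=> p; apply/ind_eqP; exists 1%g; rewrite act1 mul1g. Qed.

Lemma ind_eq_sub p q : ind_eq p q -> ind_eq q p.
Proof.
case/ind_eqP=> h [Hh e1 e2]; apply/ind_eqP; exists h^-1%g.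
by rewrite groupV e1 e2 mulKg -actMin ?groupV // mulgV act1.
Qed.

Lemma ind_eq_sym : symmetric ind_eq.
Proof. by move=> p q; apply/idP/idP; apply: ind_eq_sub. Qed.

Lemma ind_eq_trans : transitive ind_eq.
Proof.
move=> q p r /ind_eqP[h [Hh e1 e2]] /ind_eqP[k [Hk e3 e4]].
apply/ind_eqP; exists (h * k)%g; split; first exact: groupM.
  by rewrite e3 e1 actMin.
by rewrite e2 e4 mulgA.
Qed.

Canonical ind_equiv := EquivRel ind_eq ind_eq_refl ind_eq_sym ind_eq_trans.

Definition ind_gset : finType := quot_type {eq_quot ind_eq}.

Definition ind_pi (p : S * subg_of G) : ind_gset := \pi_({eq_quot ind_eq}) p.
Definition ind_repr (u : ind_gset) : S * subg_of G :=
  repr (u : {eq_quot ind_eq}).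

Lemma ind_reprK u : ind_pi (ind_repr u) = u.
Proof. exact: reprK. Qed.

Lemma eq_ind_pi p q : ind_pi p = ind_pi q <-> ind_eq p q.
Proof.
split=> [e|/eqmodP //]; apply/(eqmodP ind_equiv); exact: e.
Qed.

Definition ind_act (u : ind_gset) (a : gT) : ind_gset :=
  ind_pi ((ind_repr u).1, (ind_repr u).2 * subg G a)%g.

Lemma ind_act_pi p a : ind_act (ind_pi p) a = ind_pi (p.1, p.2 * subg G a)%g.
Proof.
have /eq_ind_pi/ind_eqP[h [Hh e1 e2]] := ind_reprK (ind_pi p).
by apply/eq_ind_pi/ind_eqP; exists h; rewrite /= e2 mulgA.
Qed.

Lemma ind_is_action : is_action G ind_act.
Proof.
have W (P : ind_gset -> Prop) : (forall p, P (ind_pi p)) -> forall u, P u.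
  by move=> Pp u; rewrite -(ind_reprK u).
split=> [a|].
  elim/W=> p; elim/W=> q; rewrite !ind_act_pi.
  case/eq_ind_pi/ind_eqP=> h /= [Hh e1 e2]; apply/eq_ind_pi/ind_eqP.
  by exists h; split=> //; apply: (mulIg (sgval (subg G a))); rewrite -mulgA.
elim/W=> p a b Ga Gb; rewrite !ind_act_pi /=.
by congr (ind_pi (_, _)); rewrite subgM // mulgA.
Qed.
Definition ind_action := Action ind_is_action.

(* A G-set is isomorphic to S x_H G as soon as it is covered by an            *)
(* equivariant map from S x G whose fibres are the classes of ind_eq.         *)
Lemma ind_action_iso (T : finType) (toT : action G T)
    (f : S * subg_of G -> T) :
    (forall p q, f p = f q <-> ind_eq p q) -> (forall t, exists p, f p = t) ->
    (forall p a, a \in G -> f (p.1, p.2 * subg G a)%g = toT (f p) a) ->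
  action_iso ind_action toT.
Proof.
move=> fP f_surj fE; have fpi p : f (ind_repr (ind_pi p)) = f p.
  by apply/fP/eq_ind_pi; rewrite ind_reprK.
exists (fun u => f (ind_repr u)) => [|u a Ga].
  exists (fun t => ind_pi (projT1 (cid (f_surj t)))) => [u|t].
    rewrite -[RHS]ind_reprK; apply/eq_ind_pi/fP.
    by case: (cid _) => p.
  by rewrite fpi; case: (cid _).
by rewrite /= /ind_act fpi fE.
Qed.

End InducedSet.

Definition isoclass_ind (x : isoclass H) : isoclass G :=
  iso_class (ind_action (repr x)).

Lemma ind_action_map (S T : finType) (toS : action H S) (toT : action H T) :
  action_iso toS toT -> action_iso (ind_action toS) (ind_action toT).
Proof.
case=> f [f' fK f'K] fE.
apply: (ind_action_iso (f := fun p => ind_pi toT (f p.1, p.2))).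
- move=> [x g] [y k]; rewrite eq_ind_pi.
  split=> /ind_eqP[h /= [Hh e1 e2]]; apply/ind_eqP; exists h; split=> //=.
    by apply: (can_inj fK); rewrite fE.
  by rewrite e1 fE.
- move=> u; exists (f' (ind_repr u).1, (ind_repr u).2).
  by rewrite f'K -[RHS]ind_reprK; case: (ind_repr u).
- by move=> [x g] a Ga; rewrite /= ind_act_pi.
Qed.

Lemma isoclass_indE (T : finType) (to : action H T) :
  isoclass_ind (iso_class to) = iso_class (ind_action to).
Proof. exact/eq_iso_class/ind_action_map/repr_iso_class. Qed.

Lemma isoclass_ind_is_nmod_morphism : nmod_morphism isoclass_ind.
Proof.
split=> [|].
  rewrite -!iso_class0 isoclass_indE; apply/eq_iso_class.
  apply: (ind_action_iso (f := fst)); [by case=> -[] | by case | by case=> -[]].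
elim/isoclassW=> S tS; elim/isoclassW=> T tT.
rewrite -iso_classD !isoclass_indE -iso_classD; apply/eq_iso_class.
pose f (p : (S + T) * subg_of G) := match p.1 with
  | inl s => inl (ind_pi tS (s, p.2)) | inr t => inr (ind_pi tT (t, p.2)) end.
apply: (ind_action_iso (f := f)).
- case=> [[x|x] g] [[y|y] k]; rewrite /f /=; split=> //.
  + by case=> /eq_ind_pi/ind_eqP[h /= [Hh -> e]]; apply/ind_eqP; exists h.
  + case/ind_eqP=> h /= [Hh [e1] e2].
    by congr inl; apply/eq_ind_pi/ind_eqP; exists h.
  + by case/ind_eqP=> h [].
  + by case/ind_eqP=> h [].
  + by case=> /eq_ind_pi/ind_eqP[h /= [Hh -> e]]; apply/ind_eqP; exists h.
  + case/ind_eqP=> h /= [Hh [e1] e2].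
    by congr inr; apply/eq_ind_pi/ind_eqP; exists h.
- case=> u; rewrite -(ind_reprK u); case: (ind_repr u) => x g.
    by exists (inl x, g).
  by exists (inr x, g).
- by case=> [[x|x] g] a Ga; rewrite /f /= ind_act_pi.
Qed.

HB.instance Definition _ := GRing.isNmodMorphism.Build (isoclass H) (isoclass G)
  isoclass_ind isoclass_ind_is_nmod_morphism.

Definition QInd : {linear Qburnside H -> Qburnside G} :=
  tens_map (groth_map isoclass_ind).

Lemma QInd_class (T : finType) (to : action H T) :
  QInd (Qclass to) = Qclass (ind_action to).
Proof. by rewrite /QInd /Qclass /= tens_mapE /= groth_map_of /= isoclass_indE. Qed.

End Induction.

Section InducedCosets.
Variables (gT : finGroupType) (K H G : {group gT}).
Hypotheses (sKH : K \subset H) (sHG : H \subset G).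

Lemma coset_ind_subproof (p : coset_gset K H * subg_of G) :
  (val p.1 :* val p.2 \in rcosets K G)%g.
Proof.
case: p => [[A /= /rcosetsP[x Hx ->]] g]; rewrite -rcosetM.
apply/rcosetsP; exists (x * val g)%g => //; apply: groupM; last exact: subgP.
exact: (subsetP sHG).
Qed.

Lemma coset_ind_iso :
  action_iso (ind_action G (coset_action K H)) (coset_action K G).
Proof.
pose f p : coset_gset K G :=
  exist (fun A : {set gT} => A \in rcosets K G) _ (coset_ind_subproof p).
apply: (ind_action_iso (f := f)).
- move=> p q; split=> [[/= e]|/ind_eqP[h [Hh e1 e2]]]; last first.
    by apply: val_inj; rewrite /= e1 e2 val_coset_action // -!rcosetM.
  set h := (val p.2 * (val q.2)^-1)%g.
  have e1 : val q.1 = (val p.1 :* h)%g by rewrite rcosetM e -rcosetM mulgV rcoset1.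
  have Hh : h \in H.
    have /rcosetsP[x Hx ex] := valP p.1; have /rcosetsP[y Hy ey] := valP q.1.
    move: e1; rewrite ex ey -rcosetM => e1.
    have : (x * h \in K :* y)%g by rewrite e1 rcoset_refl.
    case/rcosetP=> c /(subsetP sKH) Hc exh.
    by rewrite -(groupMl _ Hx) exh groupM.
  apply/ind_eqP; exists h; split=> //; last by rewrite mulgKV.
  by apply: val_inj; rewrite val_coset_action.
- case=> A GA; have /rcosetsP[x Gx eA] := GA.
  have KK : (K : {set gT}) \in rcosets K H.
    by apply/rcosetsP; exists 1%g; rewrite ?rcoset1.
  exists (exist (fun A : {set gT} => A \in rcosets K H) _ KK, subg G x).
  by apply: val_inj; rewrite /= subgK.
- by move=> p a Ga; apply: val_inj; rewrite val_coset_action //= subgK // rcosetM.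
Qed.

Lemma QInd_coset :
  QInd H G (Qclass (coset_action K H)) = Qclass (coset_action K G).
Proof.
by rewrite QInd_class /Qclass; congr (tens _ (groth_of _)); apply/eq_iso_class/coset_ind_iso.
Qed.

End InducedCosets.

Section DerivedSubgroups.
Variables (gT : finGroupType) (G H : {group gT}).

(* In MathComp, K :^ g = g^-1 K g. *)
Inductive DS : {group gT} -> Prop :=
| DS_base : DS H
| DS_step (K : {group gT}) (g : gT) : DS K -> g \in G -> DS (K :^ g :&: H)%G.

(* K :^: G is the G-conjugacy class of K. *)
Definition derived_classes (C : {set {set gT}}) : Prop :=
  exists2 K : {group gT}, DS K & C = (K :^: G)%g.

End DerivedSubgroups.

Definition in_span (R : pzRingType) (V : lmodType R) (S : V -> Prop) (v : V) :=
  exists (n : nat) (c : 'I_n -> R) (w : 'I_n -> V),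
    (forall i, S (w i)) /\ v = \sum_(i < n) c i *: w i.

Definition QW (gT : finGroupType) (G H : {group gT}) (v : Qburnside G) : Prop :=
  in_span (fun w => exists K : {group gT},
    [/\ K \subset G, derived_classes G H (K :^: G)%g
      & w = Qclass (coset_action K G)]) v.
Arguments QW {gT} G H v.

(* Main.v *)
Require Import Defs.
From mathcomp Require Import all_boot all_order all_fingroup all_algebra.

(* Let X = H\G and let T_k be the G-set of injective k-tuples in X. The       *)
(* element v = \sum_(1 <= k <= #|X|) (-1)^(k-1) / k! [T_k] does the job:      *)
(* - Restricted to H, X has a fixed point y. With b_k the class of the        *)
(*   injective k-tuples avoiding y, sorting the tuples by the position of y   *)
(*   gives Res [T_k] = b_k + k b_(k-1), so Res v telescopes to b_0 = 1.       *)
(* - Every orbit of T_k contains a tuple whose first entry is the coset H;    *)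
(*   its stabilizer is an intersection of H with conjugates of H, and the     *)
(*   derived subgroups are closed under intersection with conjugates of H.    *)
(* - By Frobenius reciprocity Ind (u * Res x) = Ind u * x, two elements v, v' *)
(*   of Im Ind that restrict to 1 satisfy v' = v' * v = v * v' = v.           *)

(** The coefficients are forced by telescoping: with c_k = (-1)^k / k! and n = #|X|, the relation
    between T_k and the b_k ([Qclass_inj_action]) turns Res v into the sum over k < n of c_k b_k -
    c_(k+1) b_(k+1), that is, c_0 b_0 - c_n b_n. Here b_0 is a point, and b_n is empty because an
    injective n-tuple in X must hit y ([Qclass_point_inj_action]). Membership of v in QW and in Im
    Ind has a single source: [Qclass_orbits] and [inj_coset_DS] write v as a combination of classes
    [K\G] with K derived, and such a K lies in H, so [K\G] is induced from [K\H]. Uniqueness rests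
    on [QInd_mul_res] and the product [tens_mul]. *)

Set Implicit Arguments.
Unset Strict Implicit.

Import GRing.Theory Num.Theory.
Local Open Scope ring_scope.

(** * The product on the rationalization of a commutative ring *)

Section QMul.
Variable A : comPzRingType.
Implicit Types x y : tensQ A.

(** The bilinear extension of the product on pure tensors, lifted one factor at a time. *)
Definition tens_mul x y : tensQ A :=
  tens_lift (fun q a => tens_lift (fun r b => tens (q * r) (a * b)) y) x.

Lemma tens_mull_biadditive (q : rat) (a : A) :
  biadditive (fun r b => tens (q * r) (a * b)).
Proof. by split=> [b r s | r b c] /=; rewrite mulrDr (tensDl, tensDr). Qed.

Lemma tens_mul_biadditive y :
  biadditive (fun q a => tens_lift (fun r b => tens (q * r) (a * b)) y).
Proof.
have lB q a := tens_lift_is_zmod_morphism (tens_mull_biadditive q a).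
have lE q a := tens_liftE (tens_mull_biadditive q a).
split=> [a q r | q a b] /=; elim/tens_ind: y => [y z ey ez|s c].
- by rewrite !lB ey ez opprD addrACA.
- by rewrite !lE mulrDl tensDl.
- by rewrite !lB ey ez opprD addrACA.
- by rewrite !lE mulrDl tensDr.
Qed.

Lemma tens_mulBl y : {morph tens_mul^~ y : x x' / x - x'}.
Proof. exact: (tens_lift_is_zmod_morphism (tens_mul_biadditive y)). Qed.

Lemma tens_mulE q r a b : tens_mul (tens q a) (tens r b) = tens (q * r) (a * b).
Proof.
rewrite /tens_mul (tens_liftE (tens_mul_biadditive _)).
exact: (tens_liftE (tens_mull_biadditive q a)).
Qed.

Lemma tens_mulBr x : {morph tens_mul x : y y' / y - y'}.
Proof.
move=> y y'; elim/tens_ind: x => [x x' ex ex'|q a].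
  by rewrite !tens_mulBl ex ex' opprD addrACA -opprD.
rewrite /tens_mul !(tens_liftE (tens_mul_biadditive _)).
exact: (tens_lift_is_zmod_morphism (tens_mull_biadditive q a)).
Qed.

Lemma tens_mulC : commutative tens_mul.
Proof.
move=> x y; elim/tens_ind: x => [x x' ex ex'|q a].
  by rewrite tens_mulBl tens_mulBr ex ex'.
elim/tens_ind: y => [y y' ey ey'|r b]; first by rewrite tens_mulBl tens_mulBr ey ey'.
by rewrite !tens_mulE [q * r]mulrC [a * b]mulrC.
Qed.

Lemma tens_mul1 x : tens_mul x (tens 1 1) = x.
Proof.
elim/tens_ind: x => [x x' ex ex'|q a]; first by rewrite tens_mulBl ex ex'.
by rewrite tens_mulE !mulr1.
Qed.
End QMul.

(** * Frobenius reciprocity, from H-sets up to the rational Burnside rings *)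

Section Frobenius.
Variables (gT : finGroupType) (G H : {group gT}) (sHG : H \subset G).

(** The isomorphism sends ((x, t), g) to ([x, g], t g). Twisting t by g makes the map constant on
    H-classes and equivariant for the diagonal action; the preimage of ([x, g], t) is the class of
    ((x, t g^-1), g). *)
Lemma ind_action_prod_res (S T : finType) (toS : action H S) (toT : action G T) :
  action_iso (ind_action G (prod_action toS (toT \ sHG)%act))
             (prod_action (ind_action G toS) toT).
Proof.
have GH h : h \in H -> h \in G by apply: (subsetP sHG).
apply: (@ind_action_iso _ _ _ _ _ _ _
  (fun p => (ind_pi toS (p.1.1, p.2), toT p.1.2 (val p.2)))).
- move=> [[x t] g] [[y s] k] /=.
  split=> [[/eq_ind_pi/ind_eqP[h /= [Hh -> e]] e2]|/ind_eqP[h /= [Hh [e1 e2] e]]].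
    apply/ind_eqP; exists h; split=> //=; congr (_, _).
    by apply: (act_inj toT (sgval k)); rewrite -e2 e actMin ?subgP ?GH.
  congr (_, _); first by apply/eq_ind_pi/ind_eqP; exists h.
  by rewrite e2 e actMin ?subgP ?GH.
- move=> [u t]; exists (((ind_repr u).1, toT t (val (ind_repr u).2)^-1)%g, (ind_repr u).2).
  rewrite /= -actMin ?groupV ?subgP // mulVg act1; congr (_, _).
  by rewrite -[RHS]ind_reprK; case: (ind_repr u).
- move=> [[x t] g] a Ga /=; rewrite /prod_act /= ind_act_pi /=; congr (_, _).
  by rewrite actMin ?subgP //= subgK.
Qed.

Lemma isoclass_ind_mul_res (x : isoclass H) (y : isoclass G) :
  isoclass_ind G (x * isoclass_res sHG y) = isoclass_ind G x * y.
Proof.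
elim/isoclassW: x => S tS; elim/isoclassW: y => T tT.
rewrite isoclass_resE isoclass_indE -!iso_classM isoclass_indE.
exact/eq_iso_class/ind_action_prod_res.
Qed.

Lemma groth_ofM (M : comPzSemiRingType) (x y : M) :
  groth_of (x * y) = groth_of x * groth_of y.
Proof. by rewrite [RHS]pi_groth_mul /= !mul0r mulr0 !addr0. Qed.

Lemma burnside_ind_mul_res (x : burnside H) (y : burnside G) :
  groth_map (isoclass_ind G) (x * groth_map (isoclass_res sHG) y) =
  groth_map (isoclass_ind G) x * y.
Proof.
elim/quotW: x => -[a b]; elim/quotW: y => -[c d]; rewrite !pi_grothE /=.
rewrite !raddfB /= !groth_map_of !mulrBl !mulrBr !raddfB /= -!groth_ofM.
by rewrite !groth_map_of /= !isoclass_ind_mul_res.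
Qed.

Lemma QInd_mul_res (x : Qburnside H) (y : Qburnside G) :
  QInd H G (tens_mul x (QRes sHG y)) = tens_mul (QInd H G x) y.
Proof.
have iB := raddfB (QInd H G); have rB := raddfB (QRes sHG).
elim/tens_ind: y => [y y' ey ey'|r b].
  by rewrite rB !tens_mulBr -ey -ey' -iB.
elim/tens_ind: x => [x x' ex ex'|q a].
  by rewrite iB !tens_mulBl -ex -ex' -iB.
rewrite [QRes sHG _]tens_mapE tens_mulE ![QInd H G _]tens_mapE tens_mulE.
by rewrite -burnside_ind_mul_res.
Qed.
End Frobenius.

(** * Linear spans *)

Section Span.
Variables (R : pzRingType) (V : lmodType R) (S : V -> Prop).

Lemma in_span0 : in_span S 0.
Proof.
by exists 0%N, (fun=> 0), (fun=> 0); split=> [[]|]; rewrite ?big_ord0.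
Qed.

Lemma in_spanD v w : in_span S v -> in_span S w -> in_span S (v + w).
Proof.
case=> m [c [x [Sx ->]]] [n [d [y [Sy ->]]]].
exists (m + n)%N, (fun i => match split i with inl j => c j | inr j => d j end),
  (fun i => match split i with inl j => x j | inr j => y j end).
split=> [i|]; first by case: (split i).
rewrite big_split_ord; congr (_ + _); apply: eq_bigr => i _.
  by rewrite -[lshift n i]/(unsplit (inl i)) unsplitK.
by rewrite -[rshift m i]/(unsplit (inr i)) unsplitK.
Qed.

Lemma in_spanZ a v : in_span S v -> in_span S (a *: v).
Proof.
case=> n [c [x [Sx ->]]]; exists n, (fun i => a * c i), x; split=> //.
by rewrite scaler_sumr; apply: eq_bigr => i _; rewrite scalerA.
Qed.

Lemma in_span_gen v : S v -> in_span S v.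
Proof.
by exists 1%N, (fun=> 1), (fun=> v); split=> //; rewrite big_ord1 scale1r.
Qed.

Lemma in_span_sum (I : Type) (r : seq I) (P : pred I) (F : I -> V) :
  (forall i, P i -> in_span S (F i)) -> in_span S (\sum_(i <- r | P i) F i).
Proof. by move=> SF; apply: (big_ind (in_span S)); [exact: in_span0 | exact: in_spanD |]. Qed.

Lemma in_span_ind (P : V -> Prop) v :
  P 0 -> (forall x y, P x -> P y -> P (x + y)) -> (forall a x, P x -> P (a *: x)) ->
  (forall x, S x -> P x) -> in_span S v -> P v.
Proof.
move=> P0 PD PZ PS [n [c [x [Sx ->]]]].
by apply: big_ind => // i _; apply/PZ/PS.
Qed.
End Span.

(** * Decomposing a finite G-set into stable subsets and orbits *)

Section SubAction.
Variables (gT : finGroupType) (G : {group gT}).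

Lemma Qclass_iso (S T : finType) (toS : action G S) (toT : action G T) :
  action_iso toS toT -> Qclass toS = Qclass toT.
Proof. by move=> /eq_iso_class e; rewrite /Qclass e. Qed.

Lemma Qclass_sum (S T : finType) (toS : action G S) (toT : action G T) :
  Qclass (sum_action toS toT) = Qclass toS + Qclass toT.
Proof. by rewrite /Qclass iso_classD raddfD tensDr. Qed.

Lemma Qclass_empty (T : finType) (to : action G T) :
  #|T| = 0%N -> Qclass to = 0.
Proof.
move=> T0; have TF (x : T) : False by have := fintype0 x T0.
rewrite (Qclass_iso (toT := empty_action G)).
  by apply: (addrI (Qclass to)); rewrite /Qclass iso_class0 raddf0 -tensDr !addr0.
exists (fun x => False_rect void (TF x)) => [|x]; last by case: (TF x).
by exists (of_void T) => [x|[]]; case: (TF x).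
Qed.

Variables (T : finType) (to : action G T).

Definition stable (P : pred T) := forall x a, a \in G -> P x -> P (to x a).

Lemma stable_subact_dom (P : pred T) : stable P -> G \subset subact_dom P to.
Proof.
move=> sP; apply/subsetP=> a Ga; rewrite !inE Ga /=; apply/subsetP=> x.
by rewrite !inE; apply: sP.
Qed.

Definition sub_action (P : pred T) (sP : stable P) : action G {x | P x} :=
  (to^? \ stable_subact_dom sP)%act.

Lemma val_sub_action (P : pred T) (sP : stable P) u a :
  a \in G -> val (sub_action sP u a) = to (val u) a.
Proof.
by move=> Ga; rewrite /= val_subact (subsetP (stable_subact_dom sP)).
Qed.

Lemma sub_action_iso (P : pred T) (sP : stable P) (S : finType)
    (toS : action G S) (f : S -> T) :
    injective f -> (forall s, P (f s)) -> (forall t, P t -> exists s, f s = t) ->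
    (forall s a, a \in G -> f (toS s a) = to (f s) a) ->
  action_iso toS (sub_action sP).
Proof.
move=> f_inj Pf f_surj fE; exists (fun s => exist P (f s) (Pf s)) => [|s a Ga].
  apply: inj_card_bij => [s s' [/f_inj] //|].
  rewrite -(card_imset _ f_inj) card_sig; apply/subset_leq_card/subsetP=> t Pt.
  by have [s <-] := f_surj t Pt; rewrite imset_f.
by apply: val_inj; rewrite val_sub_action //= fE.
Qed.

Lemma Qclass_sub_ext (P Q : pred T) (sP : stable P) (sQ : stable Q) :
  P =1 Q -> Qclass (sub_action sP) = Qclass (sub_action sQ).
Proof.
move=> PQ; apply/Qclass_iso/sub_action_iso; first exact: val_inj.
- by move=> s; rewrite -PQ (valP s).
- by move=> t; rewrite -PQ => Pt; exists (exist P t Pt).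
- exact: val_sub_action.
Qed.

Lemma Qclass_subU (P Q U : pred T) (sP : stable P) (sQ : stable Q) (sU : stable U) :
    (forall x, U x = P x || Q x) -> (forall x, P x -> Q x -> False) ->
  Qclass (sub_action sU) = Qclass (sub_action sP) + Qclass (sub_action sQ).
Proof.
move=> UPQ PQ; rewrite -Qclass_sum; apply/esym/Qclass_iso.
apply: (@sub_action_iso _ _ _ _ (fun s => match s with inl u => val u | inr u => val u end)).
- case=> [x|x] [y|y] => [/val_inj-> // | e | e | /val_inj-> //].
    by case: (PQ (val x)); [exact: (valP x) | rewrite e; exact: (valP y)].
  by case: (PQ (val y)); [exact: (valP y) | rewrite -e; exact: (valP x)].
- by case=> x; rewrite UPQ (valP x) ?orbT.
- move=> t; rewrite UPQ => /orP[Pt|Qt]; first by exists (inl (exist P t Pt)).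
  by exists (inr (exist Q t Qt)).
- by case=> x a Ga; exact: val_sub_action.
Qed.

Definition invariant_map (I : eqType) (f : T -> I) := forall x a, a \in G -> f (to x a) = f x.

(** A general [D] covers both a single fibre and the unions of fibres met in the induction of
    [Qclass_fibers]. *)
Lemma stable_fiber (I : eqType) (f : T -> I) (P : pred T) (D : {pred I}) :
  invariant_map f -> stable P -> stable (fun x => P x && (f x \in D)).
Proof. by move=> fE sP x a Ga /andP[Px fx]; rewrite fE // sP. Qed.

Lemma Qclass_fibers (I : finType) (f : T -> I) (P : pred T)
    (fE : invariant_map f) (sP : stable P) :
  Qclass (sub_action sP) =
    \sum_(i : I) Qclass (sub_action (stable_fiber (D := pred1 i) fE sP)).
Proof.
(* With the index set seen as a list, fibres split off one at a time; uniqueness of the list makes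
   them disjoint. *)
rewrite (Qclass_sub_ext _ (stable_fiber (D := [in index_enum I]) fE sP)); last first.
  by move=> x; rewrite -topredE /= mem_index_enum andbT.
elim: (index_enum I) (index_enum_uniq I) => [_|i r IHr /= /andP[ir /IHr e]].
  rewrite big_nil Qclass_empty // card_sig; apply: eq_card0 => x.
  by rewrite !inE andbF.
rewrite big_cons -e; apply: Qclass_subU => [x|x]; first by rewrite !inE andb_orr.
by move=> /andP[_ /eqP->] /andP[_]; exact/negP.
Qed.

Lemma orbit_invariant : invariant_map (orbit to G).
Proof. by move=> x a Ga; apply/orbit_in_eqP; rewrite ?mem_orbit. Qed.

Lemma coset_orbit_iso (K : {group gT}) (P : pred T) (sP : stable P) t :
    K \subset G -> P t -> (forall a, a \in G -> to t a = t <-> a \in K) ->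
  action_iso (coset_action K G)
    (sub_action (stable_fiber (D := pred1 (orbit to G t)) orbit_invariant sP)).
Proof.
move=> sKG Pt tK; pose F (A : coset_gset K G) := to t (repr (val A)).
have toE x y : x \in G -> y \in (K :* x)%g -> to t y = to t x.
  move=> Gx /rcosetP[k Kk ->]; have Gk := subsetP sKG k Kk.
  by rewrite actMin // (tK k Gk).2.
have repP (A : coset_gset K G) : exists x, [/\ x \in G, val A = (K :* x)%g & F A = to t x].
  have /rcosetsP[x Gx eA] := valP A; exists x; split=> //.
  by rewrite /F eA (toE x) // mem_repr_rcoset.
apply: (@sub_action_iso _ _ _ _ F).
- move=> A B; have [x [Gx eA ->]] := repP A; have [y [Gy eB ->]] := repP B.
  move=> e; apply: val_inj; rewrite eA eB; apply/rcoset_eqP.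
  rewrite mem_rcoset; apply/tK; first by rewrite groupM ?groupV.
  by rewrite actMin ?groupV // e -actMin ?groupV // mulgV act1.
- move=> A; have [x [Gx _ ->]] := repP A; rewrite sP // andTb.
  by rewrite !inE orbit_invariant.
- move=> u /andP[_ /eqP/orbit_in_eqP]; rewrite subxx => /(_ isT)/orbitP[x Gx <-].
  have KG : (K :* x)%g \in rcosets K G by apply/rcosetsP; exists x.
  by exists (exist (fun A : {set gT} => A \in rcosets K G) _ KG);
    rewrite /F (toE x) //= mem_repr_rcoset.
- move=> A a Ga; have [x [Gx eA ->]] := repP A.
  rewrite -actMin // /F val_coset_action // eA -rcosetM; apply: toE.
    exact: groupM.
  exact: mem_repr_rcoset.
Qed.

(** The stabilizer of any one point determines an orbit up to isomorphism, so it suffices that each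
    orbit contains some point t x with a stabilizer in [Q]. *)
Lemma Qclass_orbits (Q : {group gT} -> Prop) (P : pred T) (sP : stable P) :
    (forall t, P t -> exists x (K : {group gT}), [/\ x \in G, K \subset G, Q K &
       forall a, a \in G -> to (to t x) a = to t x <-> a \in K]) ->
  in_span (fun w => exists K : {group gT},
     [/\ K \subset G, Q K & w = Qclass (coset_action K G)])
   (Qclass (sub_action sP)).
Proof.
move=> PQ; rewrite (Qclass_fibers orbit_invariant); apply: in_span_sum => O _.
(* The index O runs over all subsets of T; those that are not the orbit of a point of P contribute
   an empty G-set. *)
have [/existsP[t /andP[Pt /eqP eO]]|noO] :=
    boolP [exists t, P t && (orbit to G t == O)]; last first.
  rewrite Qclass_empty; first exact: in_span0.
  rewrite card_sig; apply: eq_card0 => t; apply/negbTE; rewrite !inE.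
  by apply: contra noO => Pt; apply/existsP; exists t.
have [x [K [Gx sKG QK xK]]] := PQ t Pt.
apply: in_span_gen; exists K; split=> //; apply/esym/Qclass_iso.
have -> : O = orbit to G (to t x) by rewrite orbit_invariant.
by apply: coset_orbit_iso => //; apply: sP.
Qed.

End SubAction.

(** * The G-sets of injective tuples *)

Section Tuples.
Variables (gT : finGroupType) (G : {group gT}) (T : finType) (to : action G T).
Variable (k : nat).

Definition ffun_act (f : {ffun 'I_k -> T}) (a : gT) : {ffun 'I_k -> T} :=
  [ffun i => to (f i) a].

Lemma ffun_is_action : is_action G ffun_act.
Proof.
split=> [a f g /ffunP e|f a b Ga Gb]; apply/ffunP=> i.
  by apply: (act_inj to a); have := e i; rewrite !ffunE.
by rewrite !ffunE actMin.
Qed.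
Definition ffun_action := Action ffun_is_action.

Lemma injective_stable : stable ffun_action (fun f => injectiveb f).
Proof.
move=> f a Ga /injectiveP f_inj; apply/injectiveP=> i j.
by rewrite /= !ffunE => /act_inj/f_inj.
Qed.

Definition inj_action := sub_action injective_stable.

Lemma avoid_stable y : (forall a, a \in G -> to y a = y) ->
  stable ffun_action (fun f => injectiveb f && [forall i, f i != y]).
Proof.
move=> yG f a Ga /andP[f_inj /forallP fy]; rewrite injective_stable //=.
apply/forallP=> i; rewrite ffunE -[X in _ != X](yG a Ga).
by apply: contra (fy i) => /eqP/act_inj->.
Qed.
End Tuples.

(** * Injective tuples in a G-set with a fixed point y, and the telescoping sum *)

Section Telescope.
Variables (gT : finGroupType) (G : {group gT}) (T : finType) (to : action G T).
Variables (y : T) (yG : forall a, a \in G -> to y a = y).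

Local Notation avoid k := (Qclass (sub_action (avoid_stable (k := k) yG))).

Lemma position_invariant k :
  invariant_map (ffun_action to k) (fun f : {ffun 'I_k -> T} => [pick i | f i == y]).
Proof.
move=> f a Ga; apply: eq_pick => i /=.
by rewrite ffunE -{1}(yG Ga) (inj_eq (act_inj to a)).
Qed.

Definition insert_at k (i : 'I_k.+1) (g : {ffun 'I_k -> T}) : {ffun 'I_k.+1 -> T} :=
  [ffun j => if unlift i j is Some j' then g j' else y].

(** Sort the injective tuples by the position of y, which is invariant because y is fixed. Those
    without y form the first term; for each of the k+1 positions, deleting y leaves an injective
    k-tuple that avoids y, and [insert_at] is the inverse. *)
Lemma Qclass_inj_action k :
  Qclass (inj_action to k.+1) = avoid k.+1 + k.+1%:R *: avoid k.
Proof.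
rewrite [LHS](Qclass_fibers (@position_invariant _)).
rewrite (bigD1 None) //=; congr (_ + _).
  apply: Qclass_sub_ext => f; rewrite !inE; congr andb.
  case: pickP => [i fi|fy] /=; first by apply/esym/negbTE/forallPn; exists i; rewrite fi.
  by rewrite eqxx; apply/esym/forallP=> i; rewrite fy.
(* The default [ord0] is never reached, since [None] has been split off. *)
rewrite (reindex_onto Some (odflt ord0)) /=; last by case.
rewrite (eq_big xpredT (fun=> avoid k)) => [|i|i _]; last 1 first.
- apply/esym/Qclass_iso.
  apply: (@sub_action_iso _ _ _ _ _ _ _ _ (fun u => insert_at i (val u))).
  + move=> u v /ffunP e; apply/val_inj/ffunP=> j.
    by have := e (lift i j); rewrite !ffunE liftK.
  + case=> g /= /andP[/injectiveP g_inj /forallP gy]; apply/andP; split.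
      apply/injectiveP=> j j'; rewrite !ffunE.
      case: unliftP => [l ->|->]; case: unliftP => [l' ->|->] // e.
      * by rewrite (g_inj _ _ e).
      * by have := gy l; rewrite e eqxx.
      * by have := gy l'; rewrite -e eqxx.
    rewrite inE; case: pickP => [j|/(_ i)]; last by rewrite ffunE unlift_none eqxx.
    rewrite ffunE; case: unliftP => [l _ gl|-> _ //].
    by have := gy l; rewrite gl.
  + move=> f /andP[/injectiveP f_inj]; rewrite inE.
    case: pickP => // j /eqP fj /eqP[ej]; rewrite {}ej in fj.
    (* The preimage of f is f with its entry y at position i deleted. *)
    have gP : injectiveb [ffun l => f (lift i l)] &&
        [forall l, [ffun l => f (lift i l)] l != y].
      apply/andP; split.
        by apply/injectiveP=> l l'; rewrite !ffunE => /f_inj/lift_inj.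
      apply/forallP=> l; rewrite ffunE -fj (inj_eq f_inj) eq_sym.
      exact: neq_lift.
    exists (exist _ [ffun l => f (lift i l)] gP); apply/ffunP=> l; rewrite ffunE.
    by case: unliftP => [l' ->|->]; rewrite ?ffunE.
  + move=> u a Ga; rewrite val_sub_action //; apply/ffunP=> j; rewrite !ffunE.
    by case: unliftP => [l _|_]; rewrite ?ffunE ?yG.
- by rewrite sumr_const card_ord scaler_nat.
- by rewrite /= eqxx.
Qed.

Lemma Qclass_avoid0 : avoid 0 = Qclass (point_action G).
Proof.
have no_i (i : 'I_0) : False by case: i.
apply/esym/Qclass_iso.
apply: (@sub_action_iso _ _ _ _ _ _ _ _ (fun=> [ffun i => False_rect T (no_i i)])).
- by move=> [] [].
- by move=> _; apply/andP; split; [apply/injectiveP=> i | apply/forallP=> i]; case: (no_i i).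
- by move=> f _; exists tt; apply/ffunP=> i; case: (no_i i).
- by move=> _ a _; apply/ffunP=> i; case: (no_i i).
Qed.

Lemma Qclass_avoid_card : avoid #|T| = 0.
Proof.
rewrite Qclass_empty // card_sig; apply: eq_card0 => f; apply/negbTE; rewrite inE.
apply/negP=> /andP[/injectiveP f_inj /forallP fy].
have [|g fK gK] := inj_card_bij f_inj; first by rewrite card_ord.
by have := fy (g y); rewrite gK eqxx.
Qed.

Lemma Qclass_point_inj_action :
  \sum_(k < #|T|) ((-1) ^+ k / (k.+1)`!%:R) *: Qclass (inj_action to k.+1) =
  Qclass (point_action G).
Proof.
pose c k : rat := (-1) ^+ k / k`!%:R.
transitivity (\sum_(k < #|T|) (c k *: avoid k - c k.+1 *: avoid k.+1)).
  apply: eq_bigr => k _; rewrite Qclass_inj_action scalerDr scalerA addrC.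
  (* Both coefficients come from (k+1)! = (k+1) k!: (-1)^k (k+1) / (k+1)! is c_k, and (-1)^k /
     (k+1)! is - c_(k+1). *)
  congr (_ *: _ + _).
    rewrite /c factS natrM invfM mulrA mulrAC divfK //.
    by rewrite pnatr_eq0.
  by rewrite /c exprS mulN1r mulNr scaleNr opprK.
rewrite -(big_mkord xpredT (fun k => c k *: avoid k - c k.+1 *: avoid k.+1)).
rewrite (telescope_sumr_eq (fun k => - (c k *: avoid k))) //.
  by rewrite Qclass_avoid_card Qclass_avoid0 scaler0 oppr0 opprK add0r /c divr1 scale1r.
by move=> k _; rewrite opprK addrC.
Qed.
End Telescope.

(** * Closure of the derived subgroups under intersection with conjugates of H *)

Section Derived.
Local Open Scope group_scope.
Variables (gT : finGroupType) (G H : {group gT}).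

Lemma DS_sub K : DS G H K -> K \subset H.
Proof. by case=> [|L g _ _] //; apply: subsetIr. Qed.

(** By induction on K with g general, because (L^a :&: H) :&: H^g = (L :&: H^(g a^-1))^a :&: H. *)
Lemma DS_conjI K g : DS G H K -> g \in G -> DS G H (K :&: H :^ g)%G.
Proof.
move=> DK; elim: DK g => [|L a DL IH Ga] g Gg.
  rewrite (_ : (H :&: H :^ g)%G = (H :^ g :&: H)%G); last by apply/val_inj/setIC.
  exact/DS_step/Gg/DS_base.
have := DS_step (IH (g * a^-1)%g _) Ga; rewrite groupM ?groupV // => /(_ isT).
congr (DS G H _); apply: val_inj => /=.
by rewrite conjIg -conjsgM mulgKV setIAC.
Qed.

Lemma DS_bigcap (I : Type) (r : seq I) (g : I -> gT) :
  (forall i, g i \in G) ->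
  exists2 K : {group gT}, DS G H K & K :=: H :&: \bigcap_(i <- r) H :^ (g i).
Proof.
move=> Gg; elim: r => [|i r [K DK eK]].
  by exists H; [exact: DS_base | rewrite big_nil setIT].
exists (K :&: H :^ g i)%G; first exact: DS_conjI.
by rewrite big_cons /= eK -setIA [in RHS]setIC -setIA [in LHS]setICA setIA setIC.
Qed.
End Derived.

(** * Stabilizers of tuples of cosets *)

Section Cosets.
Local Open Scope group_scope.
Variables (gT : finGroupType) (G H : {group gT}) (sHG : H \subset G).
Local Notation toX := (coset_action H G).

Lemma coset_stab (A : coset_gset H G) x a : x \in G -> val A = (H :* x)%g ->
  a \in G -> toX A a = A <-> a \in (H :^ x)%g.
Proof.
move=> Gx eA Ga; rewrite mem_conjg conjgE invgK mulgA -mem_rcoset.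
have -> : toX A a = A <-> val (toX A a) = val A by split=> [->|/val_inj].
rewrite val_coset_action // eA -rcosetM; split=> [/rcoset_eqP|] //.
by move/rcoset_eqP.
Qed.

(** If the first entry is H x, translating by x^-1 makes it H. The stabilizer of the new tuple is
    the intersection of those of its entries, which are conjugates of H and include H itself. The
    length k+1 guarantees a first entry. *)
Lemma inj_coset_DS k (f : {ffun 'I_k.+1 -> coset_gset H G}) :
  exists x (K : {group gT}), [/\ x \in G, K \subset G, DS G H K & forall a, a \in G ->
    ffun_action toX k.+1 (ffun_action toX k.+1 f x) a = ffun_action toX k.+1 f x
      <-> a \in K].
Proof.
have /rcosetsP[x Gx e0] := valP (f ord0).
exists x^-1%g; set f' := ffun_action _ _ f _.
have e0' : val (f' ord0) = H.
  by rewrite ffunE val_coset_action ?groupV // e0 -rcosetM mulgV rcoset1.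
have gP (A : coset_gset H G) : {g | g \in G & val A == (H :* g)%g}.
  by apply: sig2W; have /rcosetsP[g] := valP A; exists g => //; apply/eqP.
pose g A := s2val (gP A); have gG A : g A \in G := s2valP (gP A).
have [K DK eK] := DS_bigcap H (index_enum 'I_k.+1) (fun i => gG (f' i)).
exists K; split=> //; first by rewrite groupV.
  exact: subset_trans (DS_sub DK) sHG.
move=> a Ga; rewrite eK inE.
have fix_i i : toX (f' i) a = f' i <-> a \in (H :^ g (f' i))%g.
  exact: coset_stab (gG _) (eqP (s2valP' (gP (f' i)))) Ga.
split=> [/ffunP e|/andP[Ha /bigcapP aK]].
  have ei i : toX (f' i) a = f' i by rewrite -{2}e [RHS]ffunE.
  apply/andP; split; last by apply/bigcapP=> i _; apply/fix_i.
  (* The factor H of the intersection is the stabilizer of the first entry, the coset of 1. *)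
  have := (coset_stab (A := f' ord0) (x := 1%g) (group1 G) _ Ga).1 (ei ord0).
  by rewrite conjsg1 rcoset1; apply.
by apply/ffunP=> i; rewrite ffunE; apply/fix_i/aK.
Qed.

Lemma coset_self_point : action_iso (coset_action H H) (point_action H).
Proof.
have HH : (H : {set gT}) \in rcosets H H.
  by apply/rcosetsP; exists 1; rewrite ?rcoset1.
exists (fun=> tt) => //.
exists (fun=> exist (fun A : {set gT} => A \in rcosets H H) _ HH); last by case.
by move=> A; apply: val_inj; have /rcosetsP[h Hh ->] := valP A; rewrite rcoset_id.
Qed.

End Cosets.

(** * The element restricting to 1, and its uniqueness *)

Section Unit.
Variables (gT : finGroupType) (G H : {group gT}) (sHG : H \subset G).
Local Notation toX := (coset_action H G).

(** In contrast to [QW], K is itself derived and not merely conjugate to a derived subgroup; hence K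
    lies in H and its class is visibly induced. *)
Definition derived_span : Qburnside G -> Prop :=
  in_span (fun w => exists K : {group gT},
    [/\ K \subset G, DS G H K & w = Qclass (coset_action K G)]).

Definition induced_unit : Qburnside G :=
  \sum_(k < #|coset_gset H G|)
    ((-1) ^+ k / (k.+1)`!%:R) *: Qclass (inj_action toX k.+1).

Lemma QRes_induced_unit : QRes sHG induced_unit = Qclass (coset_action H H).
Proof.
have HG : (H : {set gT}) \in rcosets H G.
  by apply/rcosetsP; exists 1%g; rewrite ?rcoset1.
pose y : coset_gset H G := exist (fun A : {set gT} => A \in rcosets H G) _ HG.
have yH a : a \in H -> (toX \ sHG)%act y a = y.
  move=> Ha; apply: val_inj; have Ga := subsetP sHG a Ha.
  by rewrite -[LHS]/(val (toX y a)) val_coset_action //= rcoset_id.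
rewrite (Qclass_iso (coset_self_point H)) -(Qclass_point_inj_action yH).
rewrite linear_sum; apply: eq_bigr => k _; rewrite linearZ QRes_class; congr (_ *: _).
(* Restricting the tuples and taking tuples of the restricted set give the same action of H on the
   same set. *)
apply/Qclass_iso; exists id => [|f a Ha]; first by exists id.
apply: val_inj; by rewrite !val_sub_action ?(subsetP sHG).
Qed.

Lemma induced_unit_span : derived_span induced_unit.
Proof.
apply: in_span_sum => k _; apply/in_spanZ/Qclass_orbits => f _.
exact: inj_coset_DS.
Qed.

Lemma derived_span_QInd v : derived_span v -> exists u, v = QInd H G u.
Proof.
apply: (@in_span_ind _ _ _ (fun v => exists u, v = QInd H G u)).
- by exists 0; rewrite linear0.
- by move=> _ _ [x ->] [y ->]; exists (x + y); rewrite linearD.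
- by move=> a _ [x ->]; exists (a *: x); rewrite linearZ.
- by move=> _ [K [_ /DS_sub sKH ->]]; exists (Qclass (coset_action K H)); rewrite QInd_coset.
Qed.

Lemma derived_span_QW v : derived_span v -> QW G H v.
Proof.
case=> n [c [w [wS ->]]]; exists n, c, w; split=> // i.
by have [K [sKG DK ->]] := wS i; exists K; split=> //; exists K.
Qed.

Lemma tens_mul_coset_self (x : Qburnside H) :
  tens_mul x (Qclass (coset_action H H)) = x.
Proof.
by rewrite (Qclass_iso (coset_self_point H)) [Qclass _](_ : _ = tens 1 1) ?tens_mul1.
Qed.
End Unit.

Theorem lemma5p28 (gT : finGroupType) (G H : {group gT}) (sHG : H \subset G) :
  exists v : Qburnside G,
    unique (fun v' : Qburnside G =>
              (exists u : Qburnside H, v' = QInd H G u) /\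
              QRes sHG v' = Qclass (coset_action H H)) v /\
    QW G H v.
Proof.
have spv := @induced_unit_span _ _ _ sHG.
exists (induced_unit G H); split; last exact: derived_span_QW.
have [u eu] := derived_span_QInd sHG spv.
split=> [|_ [[u' ->] ru']]; first by split; [exists u | exact: QRes_induced_unit].
(* With v = Ind u and v' = Ind u', reciprocity gives v = Ind (u * Res v') = v * v', and then v' * v
   = Ind (u' * Res v) = v'. *)
have := QInd_mul_res sHG u (QInd H G u').
rewrite ru' tens_mul_coset_self -eu => ->.
rewrite tens_mulC -(QInd_mul_res sHG).
by rewrite QRes_induced_unit tens_mul_coset_self.
Qed.
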